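(* Fix integers $k\ge 2$ and $s\ge t\ge 2$. Then, as $N\to\infty$, \[ \operatorname{ex}_{\chi\le k}(N,K_{s,t}) \le \left( \frac{1}{2}(s-t+1)^{1/t} \left(1-\frac1k\right)^{1-1/t} +o(1) \right)N^{2-1/t}. \]
   Context: All graphs are finite and simple. A graph $G$ is $F$-free if no (not necessarily induced) subgraph of $G$ is isomorphic to $F$. $K_{s,t}$ is the complete bipartite graph with sides of sizes $s$ and $t$. For an integer $k\ge1$, $\operatorname{ex}_{\chi\le k}(N,F)$ is the maximum number of edges in an $N$-vertex $F$-free graph with chromatic number at most $k$. The parameters $k,s,t$ are fixed and $o(1)$ denotes a quantity (depending on $k,s,t$) tending to $0$ as $N\to\infty$. *)

(* Defs.v *)
From HB Require Import structures.
From mathcomp Require Import all_boot.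

Set Implicit Arguments.
Unset Strict Implicit.
Unset Printing Implicit Defensive.

(* A finite simple graph on V is given by its set of edges, the edges being
   two-element subsets of V. *)
Record sgraph (V : finType) := SGraph {
  edges : {set {set V}};
  edges_card2 : [forall e in edges, #|e| == 2]
}.

HB.instance Definition _ (V : finType) := [isSub for @edges V].
HB.instance Definition _ (V : finType) := [Finite of sgraph V by <:].

(* [set x; x] has one element, so adjacency is irreflexive. *)
Definition adj (V : finType) (G : sgraph V) (x y : V) : bool :=
  [set x; y] \in edges G.

Definition colorable (V : finType) (G : sgraph V) (n : nat) : bool :=
  [exists c : {ffun V -> 'I_n},
    [forall x, forall y, adj G x y ==> (c x != c y)]].

Lemma colorable_card (V : finType) (G : sgraph V) : colorable G #|V|.
Proof.
apply/existsP; exists [ffun x => enum_rank x].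
apply/forallP => x; apply/forallP => y; apply/implyP => Gxy; rewrite !ffunE.
apply/negP => /eqP /enum_rank_inj eq_xy; move: Gxy; rewrite /adj eq_xy => Gyy.
by have /forall_inP/(_ _ Gyy) := edges_card2 G; rewrite setUid cards1.
Qed.

Definition chromatic_number (V : finType) (G : sgraph V) : nat :=
  ex_minn (ex_intro (fun n => colorable G n) #|V| (colorable_card G)).

(* The graph with vertex set A and edge set [edges H] is a (not necessarily
   induced) subgraph of G. *)
Definition subgraph (V : finType) (A : {set V}) (H G : sgraph V) : bool :=
  [forall e in edges H, e \subset A] && (edges H \subset edges G).

(* The graph with vertex set A and edge set [edges H] is isomorphic to F. *)
Definition isomorphic (V W : finType) (A : {set V}) (H : sgraph V)
    (F : sgraph W) : bool :=
  [exists f : {ffun W -> V},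
    [&& injectiveb f, [set f x | x in [set: W]] == A
      & [forall x, forall y, adj H (f x) (f y) == adj F x y]]].

Definition free (V W : finType) (F : sgraph W) (G : sgraph V) : bool :=
  ~~ [exists A : {set V}, exists H : sgraph V,
       subgraph A H G && isomorphic A H F].

Definition biclique_edges (s t : nat) : {set {set ('I_s + 'I_t)%type}} :=
  [set [set inl i; inr j] | i in [set: 'I_s], j in [set: 'I_t]].

Lemma biclique_edges_card2 (s t : nat) :
  [forall e in biclique_edges s t, #|e| == 2].
Proof. by apply/forall_inP => _ /imset2P[i j _ _ ->]; rewrite cards2. Qed.

Definition biclique (s t : nat) : sgraph ('I_s + 'I_t)%type :=
  SGraph (biclique_edges_card2 s t).

(* ex_chi k N F is ex_{chi <= k}(N, F).  The maximum is taken over a nonempty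
   family as soon as F has an edge; otherwise it may be the default value 0. *)
Definition ex_chi (k N : nat) (W : finType) (F : sgraph W) : nat :=
  \max_(G : sgraph 'I_N | free F G && (chromatic_number G <= k)) #|edges G|.

(* Main.v *)
(* Fix a proper k-colouring with classes V_j of sizes N_j. The bipartite graph
   between V_j and its complement contains no K_{t,s} with the t-side in V_j, so
   the Zarankiewicz bound of Furedi and Nikiforov gives it at most
   (s-t+1)^(1/t) N_j (N-N_j)^(1-1/t) + (t-2) N_j + (t-1) N^(2-2/t) edges.
   Summing over j counts every edge twice, and concavity of u^(1-1/t) together
   with \sum_j N_j^2 >= N^2/k bounds the sum of the main terms by
   (s-t+1)^(1/t) (1-1/k)^(1-1/t) N^(2-1/t). *)
Require Import Defs.
From mathcomp Require Import all_boot all_order all_algebra.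
From mathcomp Require Import all_classical all_reals all_analysis.
From mathcomp Require Import zify ring lra.
Import Order.TTheory GRing.Theory Num.Theory.
Import numFieldNormedType.Exports.
Local Open Scope ring_scope.

(** * Powers and falling factorials *)

(** The convex function [y ^+ t.+1] lies above its tangent at [u]. In the induction, [y] times the
    hypothesis falls short of the goal by exactly the square term [h]. *)
Lemma exp_tangent (F : realFieldType) (t : nat) (y u : F) : 0 <= y -> 0 <= u ->
  t.+1%:R * u ^+ t * y <= y ^+ t.+1 + t%:R * u ^+ t.+1.
Proof.
move=> y0 u0; elim: t => [|t IH]; first by rewrite !expr0 !expr1; lra.
have /(ler_wpM2l y0) IHy := IH.
have h : 0 <= t.+1%:R * u ^+ t * (y - u) ^+ 2.
  by rewrite mulr_ge0 ?sqr_ge0 ?mulr_ge0 ?exprn_ge0.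
rewrite -!natr1 !exprS in IHy h *; nra.
Qed.

Lemma leq_subn_exp_ffact (x t : nat) : ((x - t) ^ t.+1 <= x ^_ t.+1)%N.
Proof.
elim: t x => [|t IH] [|x] //; first by rewrite subn0 ffactn1.
by rewrite subSS ffactSS expnS leq_mul // (leq_trans (leq_subr _ _)).
Qed.

Lemma leq_ffact_exp (x t : nat) : (x ^_ t <= x ^ t)%N.
Proof.
elim: t => // t IH; rewrite ffactnSr expnSr leq_mul ?leq_subr //.
Qed.

(** * The Zarankiewicz bound for a bipartite relation *)

Section Zarankiewicz.
Context {T1 T2 : finType} (g : T1 -> T2 -> bool).
Implicit Types (A T : {set T1}) (B : {set T2}).

Definition nbr B a : {set T2} := [set b in B | g a b].
Definition conbr A b : {set T1} := [set a in A | g a b].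
Definition common_nbr B T : {set T2} := [set b in B | [forall a in T, g a b]].
(** Says that [g] has no K_{t,q+1} with its [t]-side in [A] and the other side in [B]. *)
Definition codegree_le (t q : nat) A B :=
  forall T, T \subset A -> #|T| = t -> (#|common_nbr B T| <= q)%N.

Lemma big_conbr (M : Type) (idx : M) (op : Monoid.com_law idx)
    (F : T1 -> T2 -> M) A B :
  \big[op/idx]_(b in B) \big[op/idx]_(a in conbr A b) F a b
  = \big[op/idx]_(a in A) \big[op/idx]_(b in nbr B a) F a b.
Proof.
rewrite (exchange_big_dep (mem A)) /=; last by move=> i j _; rewrite inE => /andP[].
by apply: eq_bigr => a aA; apply: eq_bigl => b; rewrite !inE aA.
Qed.

Lemma sum_nbr A B : (\sum_(a in A) #|nbr B a| = \sum_(b in B) #|conbr A b|)%N.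
Proof.
under eq_bigr do rewrite -sum1_card.
by rewrite -big_conbr; apply: eq_bigr => b _; rewrite sum1_card.
Qed.

(** Double count of the pairs (b, T) with [T] a [t]-subset of [conbr A b]: each [T] occurs with at
    most [q] vertices b. *)
Lemma sum_bin_conbr t q A B : codegree_le t q A B ->
  (\sum_(b in B) 'C(#|conbr A b|, t) <= q * 'C(#|A|, t))%N.
Proof.
move=> Q; under eq_bigr do rewrite -cards_draws -sum1_card.
rewrite (exchange_big_dep (fun T => (T \subset A) && (#|T| == t))) /=; last first.
  move=> b T _; rewrite inE => /andP[sT ->]; rewrite andbT.
  by apply: (fintype.subset_trans sT); apply/fintype.subsetP => x; rewrite inE => /andP[].
rewrite -cards_draws mulnC -sum_nat_const.
rewrite [leqRHS](eq_bigl (fun T => (T \subset A) && (#|T| == t))); last first.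
  by move=> T; rewrite inE.
apply: leq_sum => T /andP[TA /eqP Tt]; rewrite sum1dep_card.
apply: leq_trans (Q T TA Tt); apply: subset_leq_card; apply/fintype.subsetP => b.
rewrite !inE => /andP[-> /andP[/fintype.subsetP sT _]] /=.
by apply/forall_inP => a /sT; rewrite inE => /andP[].
Qed.

Lemma sum_subn_exp_conbr t q A B : codegree_le t.+1 q A B ->
  (\sum_(b in B) (#|conbr A b| - t) ^ t.+1 <= q * #|A| ^ t.+1)%N.
Proof.
move=> /sum_bin_conbr Q.
apply: leq_trans (leq_mul (leqnn q) (leq_ffact_exp _ _)).
rewrite -bin_ffact mulnA; apply: leq_trans (leq_mul Q (leqnn _)).
rewrite big_distrl /=; apply: leq_sum => b _.
by rewrite bin_ffact leq_subn_exp_ffact.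
Qed.

(** Every [T] inside [conbr A b] has [b] itself as a common neighbour, so deleting [b] removes
    one. *)
Lemma codegree_le_conbr t q A B b : b \in B ->
  codegree_le t q.+1 A B -> codegree_le t q (conbr A b) (B :\ b).
Proof.
move=> bB Q T /fintype.subsetP sT Tt; have TA : T \subset A.
  by apply/fintype.subsetP => a /sT; rewrite inE => /andP[].
have := Q T TA Tt; rewrite (cardsD1 b) inE bB /=.
have -> : [forall a in T, g a b].
  by apply/forall_inP => a /sT; rewrite inE => /andP[].
rewrite ltnS; apply: leq_trans; apply: subset_leq_card; apply/fintype.subsetP => x.
by rewrite !inE andbA.
Qed.

Section Bound.
(** [nu] and [rho] play the (t+1)-st roots of [#|B|] and [r]. The lemmas only bound [#|B|] by
    [nu ^+ t.+1], so the same [nu] survives deletions from [B]. *)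
Context {F : realFieldType} (t r : nat) (nu rho : F).
Hypotheses (nu_gt0 : 0 < nu) (rho_ge1 : 1 <= rho).
Hypothesis rhoX : rho ^+ t.+1 = r%:R.

(* Tangent-line form of the power mean inequality, taken at the value
   [rho * #|A| / nu] of the right-hand degrees that is extremal. *)
Lemma zarankiewicz_KST A B :
  #|B|%:R <= nu ^+ t.+1 -> codegree_le t.+1 r A B ->
  (\sum_(a in A) #|nbr B a|)%:R <= rho * nu ^+ t * #|A|%:R + t%:R * nu ^+ t.+1.
Proof.
move=> Bnu /sum_subn_exp_conbr; rewrite sum_nbr.
(* Replacing degrees by [y] costs at most [t] per vertex of [B]; this is the error term. *)
set y := fun b => (#|conbr A b| - t)%N => H.
have nu_ge0 := ltW nu_gt0; have rho_gt0 : 0 < rho by apply: lt_le_trans rho_ge1.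
have degle : (\sum_(b in B) #|conbr A b|)%:R
    <= (\sum_(b in B) y b)%:R + t%:R * nu ^+ t.+1.
  apply: (@le_trans _ _ ((\sum_(b in B) y b)%:R + t%:R * #|B|%:R)); last first.
    by rewrite lerD2l ler_wpM2l.
  rewrite -natrM -natrD ler_nat mulnC -sum_nat_const -big_split /=.
  by apply: leq_sum => b _; rewrite addnC -leq_subLR.
apply: (le_trans degle); rewrite lerD2r.
(* For empty [A] the tangent point [u] would be 0, and [c_gt0] could fail. *)
have [A0|A_gt0] := posnP #|A|.
  rewrite A0 mulr0 big1 // => b _; apply/eqP; rewrite subn_eq0.
  apply: leq_trans (leq0n _); rewrite -A0; apply: subset_leq_card.
  by apply/fintype.subsetP => x; rewrite inE => /andP[].
set u := rho * #|A|%:R / nu.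
have u_gt0 : 0 < u by rewrite divr_gt0 ?mulr_gt0 ?ltr0n.
have -> : rho * nu ^+ t * #|A|%:R = nu ^+ t.+1 * u.
  by rewrite /u exprS; field; rewrite gt_eqF.
have tangent : t.+1%:R * u ^+ t * (\sum_(b in B) y b)%:R
    <= (\sum_(b in B) y b ^ t.+1)%:R + t%:R * u ^+ t.+1 * #|B|%:R.
  rewrite !natr_sum mulr_sumr -sumr_const mulr_sumr -big_split /=.
  by apply: ler_sum => b _; rewrite mulr1 natrX exp_tangent // ltW.
have HR : (\sum_(b in B) y b ^ t.+1)%:R <= nu ^+ t.+1 * u ^+ t.+1.
  rewrite -exprMn mulrC /u divfK ?gt_eqF // exprMn rhoX -natrX -natrM ler_nat.
  exact: H.
have HB : t%:R * u ^+ t.+1 * #|B|%:R <= t%:R * u ^+ t.+1 * nu ^+ t.+1.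
  by rewrite ler_wpM2l // mulr_ge0 // exprn_ge0 // ltW.
have c_gt0 : 0 < t.+1%:R * u ^+ t by rewrite mulr_gt0 ?exprn_gt0.
rewrite -(ler_pM2l c_gt0); apply: (le_trans tangent).
have -> : t.+1%:R * u ^+ t * (nu ^+ t.+1 * u)
    = nu ^+ t.+1 * u ^+ t.+1 + t%:R * u ^+ t.+1 * nu ^+ t.+1.
  by rewrite -natr1 (exprS u); ring.
by rewrite lerD.
Qed.

(* Deleting a vertex [b] of [B] and restricting [A] to its neighbourhood lowers
   the codegree bound by one; averaging over [b] costs only lower-order terms. *)
Lemma zarankiewicz j A B :
  #|B|%:R <= nu ^+ t.+1 -> codegree_le t.+1 (r + j) A B ->
  (\sum_(a in A) #|nbr B a|)%:R
    <= (rho * nu ^+ t + j%:R) * #|A|%:R + t%:R * nu ^+ (t.+1 + j).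
Proof.
elim: j A B => [|j IH] A B Bnu.
  by rewrite addn0 addr0 addn0; exact: zarankiewicz_KST.
rewrite addnS => Q.
set D := rho * nu ^+ t + j%:R; set E := t%:R * nu ^+ (t.+1 + j).
set d : T1 -> F := fun a => #|nbr B a|%:R.
have E_ge0 : 0 <= E by rewrite mulr_ge0 // exprn_ge0 // ltW.
have nut_gt0 : 0 < nu ^+ t by rewrite exprn_gt0.
have DE : rho * nu ^+ t + j.+1%:R = D + 1 by rewrite /D -natr1 addrA.
have Dnu : nu ^+ t <= D + 1.
  have : nu ^+ t <= rho * nu ^+ t by rewrite ler_peMl // ltW.
  by have := ler0n F j; rewrite /D; lra.
(* The left side counts triples (a, b, b') with b, b' distinct neighbours of a. For fixed b they are
   the edges between [conbr A b] and [B :\ b], bounded by induction. *)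
have sumd2 : \sum_(a in A) d a * (d a - 1) <= D * (\sum_(a in A) d a) + nu ^+ t.+1 * E.
  have -> : \sum_(a in A) d a * (d a - 1)
      = \sum_(b in B) (\sum_(a in conbr A b) #|nbr (B :\ b) a|)%:R.
    under [RHS]eq_bigr do rewrite natr_sum.
    rewrite big_conbr; apply: eq_bigr => a _.
    rewrite (eq_bigr (fun=> d a - 1)); last first.
      move=> b; rewrite inE => /andP[bB gab].
      rewrite /d (cardsD1 b (nbr B a)) inE bB gab natrD addrC addKr.
      by congr (_%:R); apply: eq_card => x; rewrite !inE andbA.
    by rewrite sumr_const -[RHS]mulr_natl.
  apply: (@le_trans _ _ (\sum_(b in B) (D * #|conbr A b|%:R + E))).
    apply: ler_sum => b bB; apply: IH; last exact: codegree_le_conbr.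
    by apply: le_trans Bnu; rewrite ler_nat subset_leq_card // subsetDl.
  rewrite big_split /= -mulr_sumr -!natr_sum sum_nbr lerD2l sumr_const -mulr_natl.
  by rewrite ler_wpM2r.
rewrite natr_sum -/d DE.
(* Termwise this is (d a - (D + 1))^2 >= 0, combined with [sumd2]. *)
have excess : (D + 1) * (\sum_(a in A) d a - (D + 1) * #|A|%:R) <= nu ^+ t.+1 * E.
  apply: (@le_trans _ _ (\sum_(a in A) d a * (d a - 1) - D * (\sum_(a in A) d a))).
    rewrite mulrBr !mulr_sumr -sumr_const !mulr_sumr -!sumrB.
    apply: ler_sum => a _; have := sqr_ge0 (d a - (D + 1)); nra.
  by rewrite lerBlDl.
have -> : t%:R * nu ^+ (t.+1 + j.+1) = nu * E by rewrite addnS exprS /E mulrCA.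
rewrite -lerBlDl.
(* A positive excess allows [D + 1] to be lowered to [nu ^+ t], which then cancels. *)
have [x_le0|x_gt0] := lerP (\sum_(a in A) d a - (D + 1) * #|A|%:R) 0.
  by apply: (le_trans x_le0); rewrite mulr_ge0 // ltW.
rewrite -(ler_pM2l nut_gt0) mulrA -exprSr; apply: le_trans excess.
by rewrite ler_wpM2r // ltW.
Qed.

End Bound.
End Zarankiewicz.

(** * Optimisation over the sizes of the colour classes *)

(* With [x_j] the fraction of vertices in class [j], this is
   [\sum_j x_j (1 - x_j)^(1-1/t) <= (1-1/k)^(1-1/t)]: concavity, in the form of
   the tangent line at [1 - 1/k], and [\sum_j x_j^2 >= 1/k]. *)
Lemma sum_color_class_bound (F : realFieldType) (t k : nat) (M om : F)
    (n : 'I_k -> nat) (nu : 'I_k -> F) :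
  (0 < k)%N -> 0 < M -> 0 < om -> om ^+ t.+1 = 1 - k%:R^-1 ->
  (\sum_j n j)%:R = M ^+ t.+1 ->
  (forall j, 0 <= nu j) -> (forall j, nu j ^+ t.+1 = M ^+ t.+1 - (n j)%:R) ->
  \sum_j nu j ^+ t * (n j)%:R <= om ^+ t * M ^+ (t + t.+1).
Proof.
move=> k0 M0 om0 omX nM nu0 nuX.
set N := M ^+ t.+1; set Om := om * M.
have Om0 : 0 < Om by rewrite mulr_gt0.
have kR : k%:R != 0 :> F by rewrite pnatr_eq0 -lt0n.
have sumsq : N ^+ 2 / k%:R <= \sum_j (n j)%:R ^+ 2.
  have : 0 <= \sum_j ((n j)%:R - N / k%:R) ^+ 2 by apply: sumr_ge0 => j _; exact: sqr_ge0.
  rewrite (eq_bigr (fun j => (n j)%:R ^+ 2 + (- (2 * (N / k%:R)) * (n j)%:R + (N / k%:R) ^+ 2)));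
    last by move=> j _; ring.
  rewrite !big_split /= -mulr_sumr -natr_sum nM -/N sumr_const card_ord.
  rewrite -[(N / k%:R) ^+ 2 *+ k]mulr_natr.
  have -> : (N / k%:R) ^+ 2 * k%:R = N ^+ 2 / k%:R by field.
  have -> : - (2 * (N / k%:R)) * N = - 2 * (N ^+ 2 / k%:R) by field.
  lra.
have tangent j : t.+1%:R * nu j ^+ t * Om <= Om ^+ t.+1 + t%:R * (N - (n j)%:R).
  by rewrite /N -nuX; apply: exp_tangent => //; exact: ltW.
have c0 : 0 < t.+1%:R * Om by rewrite mulr_gt0.
rewrite -(ler_pM2l c0) mulr_sumr.
apply: (@le_trans _ _ (\sum_j (Om ^+ t.+1 + t%:R * (N - (n j)%:R)) * (n j)%:R)).
  by apply: ler_sum => j _; have := ler_wpM2r (ler0n F (n j)) (tangent j); lra.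
rewrite (eq_bigr (fun j => (Om ^+ t.+1 + t%:R * N) * (n j)%:R - t%:R * (n j)%:R ^+ 2));
  last by move=> j _; ring.
rewrite sumrB -!mulr_sumr -natr_sum nM -/N.
have -> : t.+1%:R * Om * (om ^+ t * M ^+ (t + t.+1)) = t.+1%:R * (om ^+ t.+1 * N ^+ 2).
  by rewrite /N /Om exprD !exprS; ring.
have -> : Om ^+ t.+1 = om ^+ t.+1 * N by rewrite exprMn.
have := ler_wpM2l (ler0n F t) sumsq; rewrite omX -natr1; nra.
Qed.

(** * Degrees, colourings and bicliques in a graph *)

Section Graph.
Context {V : finType} (G : sgraph V).
Implicit Types (x y : V) (S T : {set V}).

Lemma adj_irrefl x : adj G x x = false.
Proof.
apply/negP => Gxx; have /forall_inP/(_ _ Gxx) := edges_card2 G.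
by rewrite finset.setUid cards1.
Qed.

Lemma edges_le_degrees : (2 * #|edges G| <= \sum_x #|[set y | adj G x y]|)%N.
Proof.
have -> : (2 * #|edges G| = \sum_(e in edges G) \sum_(x in e) 1)%N.
  rewrite mulnC -sum_nat_const; apply: eq_bigr => e eG.
  by have /forall_inP/(_ _ eG)/eqP <- := edges_card2 G; rewrite sum1_card.
rewrite (exchange_big_dep predT) //=; apply: leq_sum => x _.
rewrite sum1dep_card.
apply: leq_trans (leq_imset_card (fun y => [set x; y]%SET) _).
apply: subset_leq_card; apply/fintype.subsetP => e; rewrite inE => /andP[eG xe].
have /forall_inP/(_ _ eG)/cards2P[a [b [_ eab]]] := edges_card2 G.
move: xe; rewrite eab !inE => /orP[]/eqP ex; apply/imsetP.
  by exists b; rewrite ?inE /adj ex // -eab.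
by exists a; rewrite ?inE /adj ex // finset.setUC // -eab.
Qed.

Lemma chromatic_number_colorable k : (chromatic_number G <= k)%N -> colorable G k.
Proof.
rewrite /chromatic_number; case: ex_minnP => m /existsP[c cP] _ mk.
apply/existsP; exists [ffun x => widen_ord mk (c x)].
apply/forallP => x; apply/forallP => y; apply/implyP => xy; rewrite !ffunE.
by have /forallP/(_ x)/forallP/(_ y)/implyP/(_ xy) := cP.
Qed.

(** Irreflexivity of adjacency forces [S] and [T] to be disjoint, so enumerating both gives an
    injection [f]. *)
Lemma biclique_not_free s t S T :
  (s <= #|S|)%N -> (t <= #|T|)%N -> (forall x y, x \in S -> y \in T -> adj G x y) ->
  ~~ Defs.free (biclique s t) G.
Proof.
move=> sS tT ST; rewrite negbK.
pose f (u : 'I_s + 'I_t) : V := match u with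
  | inl i => enum_val (widen_ord sS i) | inr j => enum_val (widen_ord tT j) end.
have fS i : f (inl i) \in S by exact: enum_valP.
have fT j : f (inr j) \in T by exact: enum_valP.
have neqST i j : f (inl i) <> f (inr j).
  by move=> eq_f; have := ST _ _ (fS i) (fT j); rewrite eq_f adj_irrefl.
have f_inj : injective f.
  move=> [i|j] [i'|j'] //=.
  - by move=> /enum_val_inj/(congr1 val)/= /val_inj ->.
  - by move=> /neqST.
  - by move=> /esym/neqST.
  - by move=> /enum_val_inj/(congr1 val)/= /val_inj ->.
(* The copy has only images of biclique edges, so [f] reflects adjacency even if [G] has edges
   inside [S] or [T]. *)
pose E : {set {set V}} := [set f @: (e : {set _}) | e in biclique_edges s t]%SET.
have E2 : [forall e in E, #|e| == 2].
  apply/forall_inP => _ /imsetP[e eB ->]; rewrite card_imset //.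
  by have /forall_inP := biclique_edges_card2 s t; exact.
apply/existsP; exists (f @: [set: _])%SET; apply/existsP; exists (SGraph E2).
apply/andP; split; first (apply/andP; split).
- by apply/forall_inP => _ /imsetP[e eB ->]; rewrite imsetS // finset.subsetT.
- apply/fintype.subsetP => _ /imsetP[_ /imset2P[i j _ _ ->] ->].
  by rewrite imsetU !imset_set1; exact: ST.
apply/existsP; exists (finfun f); apply/and3P; split.
- by apply/injectiveP => u v; rewrite !ffunE => /f_inj.
- by apply/eqP; apply: eq_imset => u; rewrite ffunE.
apply/forallP => u; apply/forallP => v; rewrite !ffunE /adj /=.
rewrite -!imset_set1 -imsetU (mem_imset _ _ (imset_inj f_inj)) //.
Qed.

Lemma free_codegree s t A : Defs.free (biclique s t) G -> (0 < s)%N ->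
  codegree_le (adj G) t s.-1 A (~: A).
Proof.
move=> fG s0 T TA Tt; rewrite leqNgt prednK //; apply: contraL fG => sle.
apply: (biclique_not_free s t (common_nbr (adj G) (~: A) T) T) => //.
  by rewrite Tt.
by move=> x y; rewrite inE => /andP[_ /forall_inP TP] /TP; rewrite /adj finset.setUC.
Qed.

End Graph.

(** * Summation over the colour classes *)

(* [nth_root] abstracts the root of order [t + 2], so that this bound involves
   only integer powers; [M], [rho] and [om] stand for the roots of [#|V|],
   of [s - (t + 2) + 1] and of [1 - 1 / k]. *)
Lemma free_chromatic_edges (F : realFieldType) (V : finType) (G : sgraph V)
    (k s t : nat) (M rho om : F) (nth_root : F -> F) :
  (forall x, 0 <= x -> 0 <= nth_root x) ->
  (forall x, 0 <= x -> nth_root x ^+ t.+2 = x) ->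
  (1 < k)%N -> (t.+2 <= s)%N -> 1 <= M -> 1 <= rho -> 0 < om ->
  M ^+ t.+2 = #|V|%:R -> rho ^+ t.+2 = (s - t.+1)%:R -> om ^+ t.+2 = 1 - k%:R^-1 ->
  Defs.free (biclique s t.+2) G -> (chromatic_number G <= k)%N ->
  #|edges G|%:R
    <= (1 / 2 * rho * om ^+ t.+1 + k%:R * t.+2%:R / M) * M ^+ (t.+1 + t.+2).
Proof.
move=> root0 rootX k1 ts M1 rho1 om0 MX rhoX omX fG /chromatic_number_colorable.
move=> /existsP[c /forallP cP].
have M0 : 0 < M by apply: lt_le_trans M1.
have X0 : 0 <= M ^+ (t.+2 + t) by rewrite exprn_ge0 // ltW.
pose A j : {set V} := [set x | c x == j]%SET.
pose nu j := nth_root #|~: A j|%:R.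
have nu0 j : 0 <= nu j by exact: root0.
have nuX j : nu j ^+ t.+2 = M ^+ t.+2 - #|A j|%:R.
  by rewrite /nu rootX // MX -(cardsC (A j)) natrD addrC addKr.
have nuM j : nu j <= M.
  by rewrite -(ler_pXn2r (ltn0Sn t.+1)) ?nnegrE ?nu0 ?(ltW M0) // nuX gerBl.
have sumA : \sum_j #|A j| = #|V|.
  rewrite -sum1_card (partition_big c xpredT) //=; apply: eq_bigr => j _.
  by rewrite -sum1_card; apply: eq_bigl => x; rewrite inE.
have class j : (\sum_(a in A j) #|nbr (adj G) (~: A j) a|)%:R
    <= (rho * nu j ^+ t.+1 + t%:R) * #|A j|%:R + t.+1%:R * M ^+ (t.+2 + t).
  (* [zarankiewicz] is stated for positive [nu]; if [nu j] is 0, the complement of the class is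
     empty. *)
  have [nz|nu_gt0] := eqVneq (nu j) 0.
    have : #|~: A j|%:R = 0 :> F by rewrite -(rootX #|~: A j|%:R) // -/(nu j) nz exprS mul0r.
    move=> /eqP; rewrite pnatr_eq0 cards_eq0 => /eqP ->.
    rewrite big1; last by move=> a _; apply/eqP; rewrite cards_eq0; apply/eqP/setP => b; rewrite !inE.
    have rho0 : 0 <= rho by lra.
    apply: addr_ge0; last exact: mulr_ge0.
    by rewrite mulr_ge0 // addr_ge0 // mulr_ge0 // exprn_ge0.
  have {}nu_gt0 : 0 < nu j by rewrite lt_def nu_gt0 nu0.
  (* Starting from [r = s - t.+1], [t] deletions account for the codegree bound [s.-1]. *)
  apply: (le_trans (@zarankiewicz V V (adj G) F t.+1 (s - t.+1) (nu j) rho nu_gt0 rho1 rhoX t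
    (A j) (~: A j) _ _)).
  - by rewrite /nu rootX.
  - have -> : (s - t.+1 + t = s.-1)%N by lia.
    by apply: free_codegree => //; lia.
  by rewrite lerD2l ler_wpM2l // lerXn2r ?nnegrE ?nu0 ?(ltW M0) ?nuM.
(* Properness puts every neighbour of a vertex outside its class. *)
have deg : (2 * #|edges G| <= \sum_j \sum_(a in A j) #|nbr (adj G) (~: A j) a|)%N.
  apply: (leq_trans (edges_le_degrees G)).
  rewrite (partition_big c xpredT) //=; apply: leq_sum => j _.
  rewrite [leqRHS](eq_bigl (fun x => c x == j)); last by move=> x; rewrite inE.
  apply: leq_sum => x /eqP cx; apply: subset_leq_card; apply/fintype.subsetP => y.
  rewrite !inE => xy; rewrite xy andbT -cx eq_sym.
  by have /forallP/(_ y)/implyP/(_ xy) := cP x.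
have total : 2 * #|edges G|%:R <= rho * (om ^+ t.+1 * M ^+ (t.+1 + t.+2))
    + t%:R * M ^+ t.+2 + k%:R * (t.+1%:R * M ^+ (t.+2 + t)).
  apply: (@le_trans _ _ (\sum_j ((rho * nu j ^+ t.+1 + t%:R) * #|A j|%:R
      + t.+1%:R * M ^+ (t.+2 + t)))).
    rewrite -natrM; apply: (@le_trans _ _ (\sum_j \sum_(a in A j) #|nbr (adj G) (~: A j) a|)%N%:R).
      by rewrite ler_nat.
    by rewrite natr_sum; apply: ler_sum => j _; exact: class.
  rewrite big_split /= sumr_const card_ord -[X in _ + X]mulr_natl lerD2r.
  rewrite (eq_bigr (fun j => rho * (nu j ^+ t.+1 * #|A j|%:R) + t%:R * #|A j|%:R));
    last by move=> j _; ring.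
  rewrite big_split /= -!mulr_sumr -natr_sum sumA MX lerD2r ler_wpM2l //; first lra.
  apply: (@sum_color_class_bound F t.+1 k M om (fun j => #|A j|) nu) => //; first lia.
  by rewrite sumA MX.
(* Both error terms are absorbed into [M ^+ (t.+2 + t)], a factor [M] below the main order. *)
have MM : M ^+ t.+2 <= M ^+ (t.+2 + t) by rewrite ler_weXn2l // leq_addr.
have split_pow : M ^+ (t.+1 + t.+2) = M * M ^+ (t.+2 + t).
  by rewrite -exprS; congr (_ ^+ _); lia.
have -> : (1 / 2 * rho * om ^+ t.+1 + k%:R * t.+2%:R / M) * M ^+ (t.+1 + t.+2)
    = 1 / 2 * (rho * (om ^+ t.+1 * M ^+ (t.+1 + t.+2))) + k%:R * t.+2%:R * M ^+ (t.+2 + t).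
  by rewrite split_pow; field; rewrite gt_eqF.
have h1 := ler_wpM2l (ler0n F t) MM.
have h2 : (t%:R + k%:R * t.+1%:R) * M ^+ (t.+2 + t)
    <= 2 * (k%:R * t.+2%:R) * M ^+ (t.+2 + t).
  by rewrite ler_wpM2r // -!natrM -natrD ler_nat; nia.
lra.
Qed.

(** * Real roots and the limit *)

Lemma powR_root_exp (R : realType) (t : nat) (x : R) :
  0 <= x -> (x `^ (1 / t.+1%:R)) ^+ t.+1 = x.
Proof.
move=> x0; rewrite -powR_mulrn ?powR_ge0 // -powRrM mul1r mulVf ?pnatr_eq0 //.
by rewrite powRr1.
Qed.

Local Open Scope classical_set_scope.
Local Open Scope ring_scope.

Lemma cvg_div_powR_root (R : realType) (t : nat) (C : R) :
  0 <= C -> (fun N : nat => C / N%:R `^ (1 / t.+1%:R)) @ \oo --> (0 : R).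
Proof.
move=> C0; apply/cvgrPdist_lt => e e0; near=> N.
have NX : ((C / e) ^+ t.+1 < N%:R) by near: N; exact: nbhs_infty_gtr.
have Ce : C / e < N%:R `^ (1 / t.+1%:R).
  by rewrite -(ltr_pXn2r (ltn0Sn t)) ?nnegrE ?powR_ge0 ?divr_ge0 ?(ltW e0) // powR_root_exp.
have M0 : 0 < (N%:R : R) `^ (1 / t.+1%:R) by apply: le_lt_trans Ce; rewrite divr_ge0 ?(ltW e0).
rewrite sub0r normrN ger0_norm ?divr_ge0 ?(ltW M0) //.
by rewrite ltr_pdivrMr // mulrC -ltr_pdivrMr.
Unshelve. all: by end_near.
Qed.

Theorem theorem1p1 (R : realType) (k s t : nat)
    (hk : (2 <= k)%N) (ht : (2 <= t)%N) (hst : (t <= s)%N) :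
  exists eps : nat -> R,
    eps @ \oo --> (0 : R) /\
    forall N : nat,
      (ex_chi k N (biclique s t))%:R <=
        (1 / 2 * (s%:R - t%:R + 1) `^ (1 / t%:R)
           * (1 - 1 / k%:R) `^ (1 - 1 / t%:R) + eps N)
        * N%:R `^ (2 - 1 / t%:R).
Proof.
case: t ht hst => [|[|t]] // _ hst.
(* The error coefficient of [free_chromatic_edges] with [M] the root of N. *)
exists (fun N => k%:R * t.+2%:R / N%:R `^ (1 / t.+2%:R)); split.
  by apply: cvg_div_powR_root; rewrite mulr_ge0.
move=> N; pose root (x : R) := x `^ (1 / t.+2%:R).
have root0 x : 0 <= x -> 0 <= root x by move=> _; exact: powR_ge0.
have rootX x : 0 <= x -> root x ^+ t.+2 = x by exact: powR_root_exp.
have ge1_root x : 1 <= x -> 1 <= root x.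
  move=> x1; have x0 : 0 <= x by lra.
  by rewrite -(ler_pXn2r (ltn0Sn t.+1)) ?nnegrE ?powR_ge0 // expr1n rootX.
have tR : t.+2%:R != 0 :> R by rewrite pnatr_eq0.
have t1R : t.+1%:R = t.+2%:R - 1 :> R by rewrite -[t.+2%:R]natr1 addrK.
have kR : k%:R >= 2 :> R by rewrite ler_nat.
have k_inv : 0 < k%:R^-1 :> R /\ k%:R^-1 < 1 :> R.
  by split; [rewrite invr_gt0; lra | rewrite invf_lt1; lra].
have om_gt0 : 0 < 1 - 1 / k%:R :> R by rewrite div1r; lra.
have sE : s%:R - t.+2%:R + 1 = (s - t.+1)%:R :> R.
  by rewrite natrB; [rewrite -[t.+2%:R]natr1; ring | lia].
have omE : (1 - 1 / k%:R) `^ (1 - 1 / t.+2%:R) = root (1 - 1 / k%:R) ^+ t.+1 :> R.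
  rewrite -powR_mulrn ?powR_ge0 // -powRrM; congr (_ `^ _).
  by rewrite t1R; move: (t.+2%:R) tR => a a0; field.
have NE : N%:R `^ (2 - 1 / t.+2%:R) = root N%:R ^+ (t.+1 + t.+2) :> R.
  rewrite -powR_mulrn ?powR_ge0 // -powRrM natrD; congr (_ `^ _).
  by rewrite t1R; move: (t.+2%:R) tR => a a0; field.
rewrite sE omE NE -!/(root _) /ex_chi.
(* The default 0 of the maximum requires a nonnegative right-hand side. *)
elim/big_ind: _ => [|x y hx hy|G /andP[fG cG]].
- rewrite mulr_ge0 ?addr_ge0 ?mulr_ge0 ?exprn_ge0 ?invr_ge0 ?powR_ge0 //.
- by rewrite /maxn; case: ifP.
(* [1 <= M] fails for N = 0, where there are no edges. *)
have [N0|N_gt0] := posnP N.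
  have -> : #|edges G| = 0%N.
    have := edges_le_degrees G; subst N; rewrite big_ord0; lia.
  rewrite mulr_ge0 ?addr_ge0 ?mulr_ge0 ?exprn_ge0 ?invr_ge0 ?powR_ge0 //.
apply: (@free_chromatic_edges R _ G k s t (root N%:R) (root (s - t.+1)%:R) (root (1 - 1 / k%:R)) root) => //.
- by apply: ge1_root; rewrite ler1n.
- by apply: ge1_root; rewrite ler1n subn_gt0.
- by rewrite powR_gt0.
- by rewrite rootX // card_ord.
- by rewrite rootX.
- by rewrite rootX ?ltW // div1r.
Qed.
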